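(* Let $n$ be a positive integer and let $a(n)$ be the number of triangular numbers between $1$ and $n$ (equivalently, $a(n)$ is the largest integer $m$ such that $\frac{m(m+1)}{2}\le n$). For all $v,w \in (\mathbb Z/2\mathbb Z)^n$, the integer $$\sum_{\lambda \vdash n} C_2(v, \lambda)\, C_2(w, \lambda)$$ is divisible by $2^{n-a(n)}$, where the sum runs over all partitions $\lambda$ of $n$.
   Context: Partitions are identified with their Young diagrams (row $i$ from the top has $\lambda_i$ cells, left-aligned). The $2$-residue of the cell $(i,j)$ (row $i$, column $j$) is $i-j \bmod 2 \in \mathbb Z/2\mathbb Z$. For a standard Young tableau $T$ with $n$ cells, its $2$-residue sequence is $(i_1,\dots,i_n)\in(\mathbb Z/2\mathbb Z)^n$, where $i_k$ is the $2$-residue of the cell containing the entry $k$. For $v\in(\mathbb Z/2\mathbb Z)^n$ and $\lambda\vdash n$, $C_2(v,\lambda)$ denotes the number of standard Young tableaux of shape $\lambda$ whose $2$-residue sequence is $v$. (For $v=(0,1,0,1,\dots)$, $C_2(v,\lambda)$ is the number of chess tableaux of shape $\lambda$.) *)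

(* Defs.v *)
From mathcomp Require Import all_boot all_order all_algebra.

Set Implicit Arguments.
Unset Strict Implicit.
Unset Printing Implicit Defensive.

(* A partition of n has at most n parts, each at most n: it is encoded by its
   sequence of parts, padded with zeros to length n. *)
Definition partitions_of (n : nat) : {set n.-tuple 'I_n.+1} :=
  [set la : n.-tuple 'I_n.+1 |
    [forall i : 'I_n, forall j : 'I_n, (i <= j) ==> (tnth la j <= tnth la i)]
    && (\sum_(i < n) tnth la i == n)].

(* Rows and columns are numbered from 0. *)
Definition diagram (n : nat) (la : n.-tuple 'I_n.+1) : {set 'I_n * 'I_n} :=
  [set c : 'I_n * 'I_n | c.2 < tnth la c.1].

(* Numbering rows and columns from 0 instead of 1 does not change i - j. *)
Definition residue (n : nat) (c : 'I_n * 'I_n) : 'Z_2 :=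
  ((c.1 : nat)%:R - (c.2 : nat)%:R)%R.

(* A filling of the n x n square; the value 0 marks a position with no cell. *)
Definition filling (n : nat) := {ffun 'I_n * 'I_n -> 'I_n.+1}.

Definition standard_tableau (n : nat) (la : n.-tuple 'I_n.+1)
    (T : filling n) : bool :=
  [&& [forall c : 'I_n * 'I_n, (c \in diagram la) == (0 < T c)],
      [forall k : 'I_n, #|[set c : 'I_n * 'I_n | T c == k.+1 :> nat]| == 1],
      [forall c in diagram la, forall d in diagram la,
         (c.1 == d.1) && (c.2 < d.2) ==> (T c < T d)]
    & [forall c in diagram la, forall d in diagram la,
         (c.2 == d.2) && (c.1 < d.1) ==> (T c < T d)]].

(* Component k : 'I_n concerns the entry k.+1, since entries run from 1 to n;
   the default value is never reached on a standard tableau. *)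
Definition residue_seq (n : nat) (T : filling n) : n.-tuple 'Z_2 :=
  [tuple (if [pick c : 'I_n * 'I_n | T c == k.+1 :> nat] is Some c
          then residue c else 0%R) | k < n].

Definition C2 (n : nat) (v : n.-tuple 'Z_2) (la : n.-tuple 'I_n.+1) : nat :=
  #|[set T : filling n | standard_tableau la T && (residue_seq T == v)]|.

Definition triangular (t : nat) : bool :=
  [exists m : 'I_t.+1, t == (m * m.+1) %/ 2].

Definition num_triangular (n : nat) : nat := count triangular (iota 1 n).

(* Main.v *)
Require Import Defs.
From mathcomp Require Import all_boot all_order all_algebra.
From mathcomp Require Import zify ring.

Set Implicit Arguments.
Unset Strict Implicit.
Unset Printing Implicit Defensive.
Import GRing.Theory.

(** Let [U_i], [D_i] add and remove a cell of residue [i] on partitions.  They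
    satisfy [[D_i, U_j] = delta_ij h_i] with [h_i] a scalar depending only on
    the numbers of cells of each residue (the basic representation of affine
    sl_2), and the sum in question is the vacuum expectation of
    [D_v1 ... D_vn U_wn ... U_w1], hence is determined by these relations.
    The same relations hold on strict partitions, with column residues
    0 1 1 0 0 1 1 0 ... and with [D] counting a removal twice unless it deletes
    a row.  There every path from the empty partition to [mu] contributes a
    factor [2 ^ (n - l(mu))], and a strict partition of [n] has at most [a(n)]
    rows because [l (l + 1) / 2 <= n]. *)

(** * Shapes as row-length functions *)

Section Shapes.
Variable m : nat.

(** Lengths are neither bounded nor ordered, so that [inc] and [dec] are total; [admissible] selects
    the partitions. With [m.+1] equal to n, every partition of n fits. *)
Definition shape := {ffun 'I_m.+1 -> nat}.
Implicit Types (f : shape) (a b : 'I_m.+1).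
Definition empty_shape : shape := [ffun=> 0].
Definition inc f a : shape := [ffun x => f x + (x == a)].
Definition dec f a : shape := [ffun x => f x - (x == a)].
Definition ncells (f : shape) := \sum_a f a.

Lemma incK f a : dec (inc f a) a = f.
Proof. by apply/ffunP=> x; rewrite !ffunE addnK. Qed.

Lemma decK f a : 0 < f a -> inc (dec f a) a = f.
Proof.
move=> fa; apply/ffunP=> x; rewrite !ffunE; case: eqP => [->|_] //=; lia.
Qed.

Lemma inc_dec f a b : a != b -> inc (dec f b) a = dec (inc f a) b.
Proof.
move=> ab; apply/ffunP=> x; rewrite !ffunE.
case: (x =P a) => [->|_]; first by rewrite (negbTE ab) /= !subn0.
by rewrite /= !addn0.
Qed.

Lemma ncells_inc f a : ncells (inc f a) = (ncells f).+1.
Proof.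
rewrite /ncells (eq_bigr (fun x => f x + (x == a))); last by move=> x _; rewrite ffunE.
rewrite big_split /= -[RHS]addn1; congr (_ + _).
by rewrite (bigD1 a) //= eqxx big1 // => x /negbTE ->.
Qed.

Lemma ncells_dec f a : 0 < f a -> (ncells (dec f a)).+1 = ncells f.
Proof. by move=> fa; rewrite -(ncells_inc _ a) decK. Qed.

Lemma ncells0 : ncells empty_shape = 0.
Proof. by rewrite /ncells big1 // => a _; rewrite ffunE. Qed.

Lemma leq_ncells f a : f a <= ncells f.
Proof. by rewrite /ncells (bigD1 a) //= leq_addr. Qed.

(** Natural indices spare casts between [k] and [k.+1]. The value is meaningful only for [k <= m],
    whence the case [a == m] in [admissible_dec]. *)
Definition row (f : shape) (k : nat) := f (inord k).

End Shapes.

(** * Weights of residue words and the model-free action of D_i *)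

Section Words.
Local Open Scope ring_scope.

Definition charge (i : 'Z_2) : int := if i == 0 then 1 else -1.
Definition word_charge (w : seq 'Z_2) : int := \sum_(i <- w) charge i.
(** Eigenvalue of the coroot h_i on a weight space of the basic representation, [k] being the number
    of 0-cells minus the number of 1-cells. The two values add up to the level 1. *)
Definition eta (i : 'Z_2) (k : int) : int := if i == 0 then 1 - 2 * k else 2 * k.

(* [D_i] applied to [U_w] on the vacuum, as a combination of shorter words. *)
Fixpoint derive (i : 'Z_2) (w : seq 'Z_2) : seq (int * seq 'Z_2) :=
  if w is j :: w' then
    (if i == j then [:: (eta i (word_charge w'), w')] else [::])
      ++ [seq (p.1, j :: p.2) | p <- derive i w']
  else [::].
End Words.

(* [below y x]: a row of length y may lie just under a row of length x;
   [res a x]: residue of the cell in row a, column x; [wt x]: multiplicity with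
   which [D] removes a cell in column x. *)
Record model := Model {
  below : rel nat;
  res : nat -> nat -> 'Z_2;
  wt : nat -> nat }.

(** * Up and down operators and their commutator *)

Section Model.
Variables (m : nat) (M : model).
Local Notation shape := (shape m).
Local Notation below := (below M).
Local Notation res := (res M).
Local Notation wt := (wt M).

Definition admissible (f : shape) : bool :=
  [forall k : 'I_m, below (row f k.+1) (row f k)].

Definition row_charge (a x : nat) : int := (\sum_(y < x) charge (res a y))%R.
Definition shape_charge (f : shape) : int := (\sum_(a < m.+1) row_charge a (f a))%R.

Local Open Scope ring_scope.

(** A function [u] stands for the formal combination of shapes with coefficients [u f]. After a cell
    is added, the coefficient at [f] comes from shapes with one cell fewer: hence [dec] here and
    [inc] in [down]. *)
Definition up (j : 'Z_2) (u : shape -> int) (f : shape) : int :=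
  \sum_(a | [&& (0 < f a)%N, admissible f, admissible (dec f a)
             & res a (f a).-1 == j]) u (dec f a).

Definition down (i : 'Z_2) (u : shape -> int) (f : shape) : int :=
  \sum_(a | admissible (inc f a) && (res a (f a) == i))
    (wt (f a))%:Z * u (inc f a).

Definition vacuum (f : shape) : int := (f == empty_shape m)%:Z.
(* Words of [ups] are read from right to left: the head is the last cell added. *)
Definition ups (w : seq 'Z_2) : shape -> int := foldr up vacuum w.
Definition downs (v : seq 'Z_2) (u : shape -> int) : shape -> int := foldr down u v.

Definition curvature (i : 'Z_2) (f : shape) : int :=
  \sum_(a | admissible (inc f a) && (res a (f a) == i)) (wt (f a))%:Z
  - \sum_(a | [&& (0 < f a)%N, admissible (dec f a) & res a (f a).-1 == i])
      (wt (f a).-1)%:Z.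

Definition below_monotone :=
  forall x y x' y', (x' <= x)%N -> (y <= y')%N -> below x y -> below x' y'.

(** The bound on the cells keeps row [m] empty (see [last_row0]), so no addable cell falls below the
    available rows. *)
Definition curvature_law := forall i f, admissible f ->
  (ncells f < m.+1)%N -> curvature i f = eta i (shape_charge f).

(* [dec (inc f a) b] and [f] have join [inc f a] and meet [dec f b], and
   admissible shapes form a lattice. *)
Lemma admissible_cross (f : shape) a b : below_monotone ->
  a != b -> admissible f -> admissible (dec (inc f a) b) ->
  admissible (inc f a) /\ admissible (dec f b).
Proof.
move=> mono ab /forallP Pf /forallP Pg.
have abN x : ~~ ((x == a) && (x == b)).
  by apply: contraNN ab => /andP[/eqP <- /eqP <-].
split; apply/forallP => k; move: (Pf k) (Pg k) (abN (inord k)) (abN (inord k.+1));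
  rewrite /row !ffunE; do 4!case: (_ == _) => //=; move=> H1 H2 _ _;
  first [by apply: mono H1; lia | by apply: mono H2; lia].
Qed.

(** Adding in row [a] and removing in another row [b] commute: by [admissible_cross], both
    intermediate shapes are admissible once [f] and the result are. These terms form [S]. The terms
    with [a = b] return to [f], require [i = j], and give the curvature. *)
Lemma down_up i j u f : below_monotone -> admissible f ->
  down i (up j u) f =
    up j (down i u) f + (i == j)%:R * curvature i f * u f.
Proof.
move=> mono Pf.
pose S := \sum_a \sum_(b | (b != a))
  (if [&& admissible (inc f a), res a (f a) == i, (0 < f b)%N,
    admissible (dec (inc f a) b) & res b (f b).-1 == j] then
    (wt (f a))%:Z * u (dec (inc f a) b) else 0).
have downE : down i (up j u) f = S + \sum_a (if [&& admissible (inc f a),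
    res a (f a) == i & res a (f a) == j] then (wt (f a))%:Z * u f else 0).
  rewrite /S -big_split /down [LHS]big_mkcond /=; apply: eq_bigr => a _.
  case: ifP => [/andP[Pa ra]|]; last first.
    move/negbT; rewrite negb_and => H; rewrite big1; last first.
      by move=> b _; case/orP: H => /negbTE ->; rewrite ?andbF.
    by case/orP: H => /negbTE ->; rewrite ?andbF // addr0.
  rewrite /up [X in _ * X]big_mkcond [X in _ * X](bigD1 a) //= mulrDr [LHS]addrC; congr (_ + _).
    rewrite big_distrr /=; apply: eq_bigr => b ba.
    by rewrite Pa ra /= !ffunE (negbTE ba) addn0; case: ifP; rewrite ?mulr0.
  rewrite Pa ra incK Pf ffunE eqxx addn1 /=.
  by case: ifP; rewrite ?mulr0.
have upE : up j (down i u) f = S + \sum_a (if [&& (0 < f a)%N,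
    admissible (dec f a), res a (f a).-1 == i & res a (f a).-1 == j]
    then (wt (f a).-1)%:Z * u f else 0).
  rewrite /S (exchange_big_dep predT) //= -big_split /up [LHS]big_mkcond /=.
  apply: eq_bigr => b _.
  rewrite Pf /=; case: ifP => [/and3P[fb Pb rb]|H]; last first.
    rewrite [X in _ = _ + X]ifF; last by apply/negbTE/negP=> /and4P[h1 h2 _ h3]; rewrite h1 h2 h3 in H.
    rewrite big1 ?addr0 // => a ba; rewrite ifF //; have ab : a != b by rewrite eq_sym.
    apply/negbTE/negP => /and5P[h1 h2 h3 h4 h5].
    have [_ h6] := admissible_cross mono ab Pf h4.
    by rewrite h3 h5 h6 in H.
  rewrite /down [LHS]big_mkcond [LHS](bigD1 b) //= [LHS]addrC; congr (_ + _); last first.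
    by rewrite decK // fb Pf Pb rb ffunE eqxx subn1 /= andbT.
  under [RHS]eq_bigl do rewrite eq_sym.
  apply: eq_bigr => a ab; rewrite inc_dec // ffunE (negbTE ab) subn0 fb rb /= andbT.
  case Pab: (admissible _); rewrite ?andbF //=.
  by have [-> _] := admissible_cross mono ab Pf Pab; rewrite andbT.
rewrite downE upE -addrA; congr (_ + _); apply/eqP; rewrite addrC -subr_eq; apply/eqP.
case: (i =P j) => [<-|ij]; last first.
  rewrite !mul0r !big1 ?subrr // => a _; rewrite ifF //; apply/negbTE/negP.
    by case/and4P=> _ _ /eqP-> /eqP.
  by case/and3P=> _ /eqP-> /eqP.
rewrite mul1r /curvature mulrBl; congr (_ - _); rewrite big_distrl /= [RHS]big_mkcond;
  apply: eq_bigr => a _; by rewrite !andbb.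
Qed.

End Model.

(** * Vacuum expectations are determined by the relations *)

Section Vacuum.
Variables (m : nat) (M : model).
Local Notation shape := (shape m).
Local Notation vacuum := (@vacuum m).
Local Notation admissible := (@admissible m M).
Local Notation ups := (@ups m M).
Local Notation downs := (@downs m M).
Local Notation up := (@up m M).
Local Notation down := (@down m M).
Implicit Types (f : shape) (u : shape -> int).
Local Open Scope ring_scope.

Lemma shape_charge0 : shape_charge M (empty_shape m) = 0.
Proof.
by rewrite /shape_charge big1 // => a _; rewrite ffunE /row_charge big_ord0.
Qed.

Lemma shape_charge_inc f a :
  shape_charge M (inc f a) = shape_charge M f + charge (res M a (f a)).
Proof.
rewrite /shape_charge (bigD1 a) //= [in RHS](bigD1 a) //= ffunE eqxx addn1.
rewrite {1}/row_charge big_ord_recr /= -/(row_charge M a (f a)) -!addrA.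
congr (_ + _); rewrite addrC; congr (_ + _).
by apply: eq_bigr => b /negbTE ba; rewrite ffunE ba addn0.
Qed.

(** Each letter adds one cell of its residue, so [ups w] lies in a single weight space. This makes
    the curvature a scalar depending on [w] alone, the same in every model. *)
Lemma ups_support w f : ups w f != 0 ->
  ncells f = size w /\ shape_charge M f = word_charge w.
Proof.
elim: w f => [|j w IH] f /=.
  rewrite /vacuum; case: (f =P _) => [-> _|//].
  by rewrite ncells0 shape_charge0 /word_charge big_nil.
rewrite /up => nz.
have [a] : exists a, [&& (0 < f a)%N, admissible f, admissible (dec f a),
    res M a (f a).-1 == j & ups w (dec f a) != 0].
  apply/existsP; apply: contraNT nz; rewrite negb_exists => /forallP H.
  rewrite big1 // => a /and4P[h1 h2 h3 h4]; apply/eqP.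
  by move: (H a); rewrite h1 h2 h3 h4 /= negbK.
case/and5P => fa _ _ /eqP rj /IH[<- kE]; rewrite ncells_dec //.
split=> //; rewrite -[f in LHS](@decK _ f a) // shape_charge_inc kE ffunE eqxx subn1 rj.
by rewrite /word_charge big_cons addrC.
Qed.

(** Move [down i] past the letters of [w] one at a time: each commutator contributes a scalar, and
    [down i] kills the vacuum. *)
Lemma down_ups i w f : below_monotone M -> curvature_law m M ->
  admissible f -> (ncells f < m.+1)%N ->
  down i (ups w) f = \sum_(p <- derive i w) p.1 * ups p.2 f.
Proof.
move=> mono law; elim: w f => [|j w IH] f Pf fn /=.
  rewrite big_nil /down big1 // => a _; rewrite /vacuum.
  case: (inc f a =P _) => [E|_]; last by rewrite mulr0.
  by move: (ncells_inc f a); rewrite E ncells0.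
rewrite down_up // big_cat /= [LHS]addrC; congr (_ + _).
  case: (i =P j) => _ /=; rewrite ?mul0r ?big_nil // big_seq1 mul1r.
  have [->|/ups_support[_ <-]] := eqVneq (ups w f) 0; first by rewrite !mulr0.
  by rewrite law.
rewrite big_map /= /up [RHS](eq_bigr _ (fun p _ => big_distrr _ _ _)) /=.
rewrite exchange_big /=; apply: eq_bigr => a /and4P[fa _ Pa _].
by rewrite IH //; apply: leq_trans fn; rewrite ltnS -(ncells_dec fa).
Qed.

(** Needed because [down_ups] holds only at admissible shapes with few cells: [downs v] at [f] reads
    its argument only at admissible shapes with [size v] more cells. *)
Lemma downs_ext v f u u' : admissible f ->
  (forall g, admissible g -> ncells g = (ncells f + size v)%N -> u g = u' g) ->
  downs v u f = downs v u' f.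
Proof.
elim: v f => [|i v IH] f Pf E /=; first by apply: E; rewrite ?addn0.
apply: eq_bigr => a /andP[Pa _]; congr (_ * _); apply: IH => // g Pg.
by rewrite ncells_inc addSnnS; apply: E.
Qed.

Lemma downs_linear (T : Type) (s : seq T) (c : T -> int) (u : T -> shape -> int) v f :
  downs v (fun g => \sum_(p <- s) c p * u p g) f = \sum_(p <- s) c p * downs v (u p) f.
Proof.
elim: v f => [|i v IH] f //=.
rewrite /down [RHS](eq_bigr _ (fun p _ => big_distrr _ _ _)) /= exchange_big /=.
apply: eq_bigr => a _; rewrite IH big_distrr /=; apply: eq_bigr => p _; ring.
Qed.

Lemma downs_rcons v i u f : downs (rcons v i) u f = downs v (down i u) f.
Proof. by rewrite /downs foldr_rcons. Qed.

Lemma ups0 w : ups w (empty_shape m) = (w == [::])%:Z.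
Proof.
case: w => [|j w] /=; first by rewrite /vacuum eqxx.
by rewrite /up big1 // => a; rewrite ffunE.
Qed.

End Vacuum.

(** Eliminate the innermost [down] by [down_ups]: the coefficients come from [derive], which does
    not see the model. Once [v] is exhausted, [ups0] gives a value depending only on [w]. *)
Lemma pairing_unique m M1 M2 v w :
  below_monotone M1 -> curvature_law m M1 -> admissible M1 (empty_shape m) ->
  below_monotone M2 -> curvature_law m M2 -> admissible M2 (empty_shape m) ->
  size v <= m.+1 ->
  downs M1 v (ups M1 w) (empty_shape m) = downs M2 v (ups M2 w) (empty_shape m).
Proof.
move=> mono1 law1 P1 mono2 law2 P2.
elim/last_ind: v w => [|v i IH] w; first by rewrite /= !ups0.
rewrite size_rcons => vn; rewrite !downs_rcons.
have E M : below_monotone M -> curvature_law m M -> admissible M (empty_shape m) ->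
    downs M v (down M i (ups M w)) (empty_shape m)
    = (\sum_(p <- derive i w) p.1 * downs M v (ups M p.2) (empty_shape m))%R.
  move=> mono law P; rewrite -downs_linear; apply: downs_ext => // g Pg.
  by rewrite ncells0 => gn; rewrite down_ups // gn.
by rewrite !E //; apply: eq_bigr => p _; rewrite IH // ltnW.
Qed.

(** * Computing the curvature row by row *)

Section Curvature.
Variables (m : nat) (M : model).
Hypothesis mono : below_monotone M.
Implicit Type f : shape m.

Lemma rowE f (a : 'I_m.+1) : row f a = f a.
Proof. by rewrite /row inord_val. Qed.

(** By monotonicity, lengthening row [a] can break only the comparison with the row above. *)
Lemma admissible_inc f a : admissible M f ->
  admissible M (inc f a) = (a == 0 :> nat) || below M (row f a).+1 (row f a.-1).
Proof.
move=> /forallP Pf; have am := ltn_ord a.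
have inordE k : k < m.+1 -> (inord k == a) = (k == a :> nat).
  by move=> km; rewrite -val_eqE /= inordK.
apply/forallP/idP => [P|/orP H k].
  case: posnP => //= a0; have am' : a.-1 < m by lia.
  move: (P (Ordinal am')); rewrite /row !ffunE /= prednK // !inordE; try lia.
  by rewrite eqxx addn1; apply: mono; lia.
have km := ltn_ord k; move: (Pf k); rewrite /row !ffunE !inordE; try lia.
case: (k.+1 =P a) => [E _|_]; last by apply: mono; lia.
case: H => [/eqP|]; rewrite -E //= addn1 /row => H; apply: mono H; lia.
Qed.

Lemma admissible_dec f a : admissible M f -> 0 < f a ->
  admissible M (dec f a) = (a == m :> nat) || below M (row f a.+1) (row f a).-1.
Proof.
move=> /forallP Pf fa; have am := ltn_ord a.
have inordE k : k < m.+1 -> (inord k == a) = (k == a :> nat).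
  by move=> km; rewrite -val_eqE /= inordK.
apply/forallP/idP => [P|/orP H k].
  case: (a =P m :> nat) => //= am0; have am' : a < m by lia.
  move: (P (Ordinal am')); rewrite /row !ffunE /= !inordE; try lia.
  by rewrite eqxx; apply: mono; lia.
have km := ltn_ord k; move: (Pf k); rewrite /row !ffunE !inordE; try lia.
case: (k =P a :> nat) => [E _|_]; last by apply: mono; lia.
by case: H => [/eqP|]; [lia | rewrite -E /row /= => H; apply: mono H; lia].
Qed.

(** A nonempty row [m] would force all [m.+1] rows to be nonempty, which takes [m.+1] cells. *)
Lemma last_row0 f : (forall x y, below M y x -> 0 < y -> 0 < x) ->
  admissible M f -> ncells f < m.+1 -> row f m = 0.
Proof.
move=> pos /forallP Pf; case: (posnP (row f m)) => // fm; rewrite ltnNge => /negP nle; case: nle.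
have fk d : d <= m -> 0 < row f (m - d).
  elim: d => [|d IH] dm; first by rewrite subn0.
  have dm' : m - d.+1 < m by lia.
  have /= := Pf (Ordinal dm').
  by move/pos; apply; rewrite subnSK // IH // ltnW.
rewrite -[m.+1]card_ord -sum1_card; apply: leq_sum => a _; rewrite -rowE.
by have := fk (m - a) (leq_subr _ _); rewrite subKn // -ltnS.
Qed.

Local Open Scope ring_scope.

Definition step_weight (i : 'Z_2) (a x : nat) : int :=
  if res M a x == i then (wt M x)%:Z else 0.

(* The corners between rows a and a.+1 contribute [step_weight i a.+1 y - H a x],
   so regrouping by rows leaves a telescoping sum plus the charge. *)
Lemma curvatureE i (H : nat -> nat -> int) (T : nat -> int) f :
  (forall x y, below M y x -> 0 < y -> 0 < x)%N ->
  (forall a x y, below M y x ->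
     (if below M y.+1 x then step_weight i a.+1 y else 0)
     - (if (0 < x)%N && below M y x.-1 then step_weight i a x.-1 else 0)
     = step_weight i a.+1 y - H a x) ->
  H m 0%N = T m.+1 ->
  (forall a x, step_weight i a x - H a x
     = T a - T a.+1 + (if i == 0 then - 2 else 2) * row_charge M a x) ->
  admissible M f -> (ncells f < m.+1)%N ->
  curvature M i f = T 0%N + (if i == 0 then - 2 else 2) * shape_charge M f.
Proof.
move=> pos gap Hm rowH Pf fn; rewrite /curvature.
rewrite big_mkcond /= [X in _ - X]big_mkcond /=.
rewrite (eq_bigr (fun a : 'I_m.+1 => if (a == 0%N :> nat) || below M (row f a).+1 (row f a.-1)
   then step_weight i a (row f a) else 0)); last first.
  by move=> a _; rewrite admissible_inc // /step_weight rowE; case: (_ || _).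
rewrite [X in _ - X](eq_bigr (fun a : 'I_m.+1 => if (0 < row f a)%N && ((a == m :> nat)
   || below M (row f a.+1) (row f a).-1) then step_weight i a (row f a).-1 else 0)); last first.
  move=> a _; rewrite /step_weight rowE.
  case: posnP => //= fa; rewrite admissible_dec // rowE.
  by case: (_ || _).
(* Split off the addable cell of row 0 and the removable cell of the empty row [m]; what remains
   pairs the addable cell of row [k.+1] with the removable cell of row [k]. *)
rewrite big_ord_recl big_ord_recr /= last_row0 //= addr0.
rewrite -addrA -sumrB.
rewrite (eq_bigr (fun k : 'I_m => step_weight i k.+1 (row f k.+1) - H k (row f k))); last first.
  move=> k _; rewrite /bump /= add1n -gap; last exact: (forallP Pf k).
  by rewrite [k == m :> nat]ltn_eqF ?ltn_ord.
rewrite sumrB addrA.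
rewrite -(big_ord_recl m (fun k : 'I_m.+1 => step_weight i k (row f k))).
have -> : \sum_(k < m) H k (row f k) = \sum_(k < m.+1) H k (row f k) - T m.+1.
  by rewrite big_ord_recr /= last_row0 // Hm addrK.
rewrite opprB addrA addrAC -sumrB.
rewrite (eq_bigr (fun k : 'I_m.+1 => T k - T k.+1 + (if i == 0 then - 2 else 2)
  * row_charge M k (row f k))); last by move=> k _; apply: rowH.
rewrite big_split -big_distrr /= (eq_bigr (fun k : 'I_m.+1 => - (T k.+1 - T k))); last first.
  by move=> k _; rewrite opprB.
rewrite sumrN -(big_mkord predT (fun k => T k.+1 - T k)) telescope_sumr //.
rewrite /shape_charge (eq_bigr (fun k : 'I_m.+1 => row_charge M k (f k))); last first.
  by move=> k _; rewrite rowE.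
ring.
Qed.

End Curvature.

(** * The two models and their curvature *)

Definition young := Model leq (fun a x => a%:R - x%:R)%R (fun=> 1).

(* Column residues of the shifted diagram of a strict partition: 0110 0110 ... *)
Definition strict := Model (fun y x => (y == 0) || (y < x))
  (fun _ x => (uphalf x)%:R)%R (fun x => if x is 0 then 1 else 2).

Lemma natr_Z2 n : (n%:R = (odd n)%:R :> 'Z_2)%R.
Proof. by apply/val_inj; rewrite /= !Zp_nat /= modn2; case: (odd n). Qed.

Lemma below_monotone_young : below_monotone young.
Proof. by move=> x y x' y' /= h1 h2 h3; lia. Qed.

Lemma below_monotone_strict : below_monotone strict.
Proof. by move=> x y x' y' /= h1 h2 h3; lia. Qed.

(** Residues alternate, so cells cancel in pairs and a row of odd length keeps the charge of its
    first cell. *)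
Lemma row_charge_young a x :
  row_charge young a x = (if odd x then if odd a then -1 else 1 else 0)%R.
Proof.
elim: x => [|x IH]; rewrite /row_charge ?big_ord0 //.
rewrite big_ord_recr /= -/(row_charge young a x) IH natr_Z2 [x%:R%R]natr_Z2.
by case: (odd x); case: (odd a).
Qed.

(** Columns 2k and 2k+1 have opposite residues, so a row of odd length keeps the charge of its last
    cell, of residue [x./2] mod 2. *)
Lemma row_charge_strict a x :
  row_charge strict a x = (if odd x then if odd x./2 then -1 else 1 else 0)%R.
Proof.
elim: x => [|x IH]; rewrite /row_charge ?big_ord0 //.
rewrite big_ord_recr /= -/(row_charge strict a x) IH natr_Z2 uphalf_half oddD.
by case: (odd x); case: (odd x./2).
Qed.

Lemma Z2_cases (i : 'Z_2) : i = 0%R \/ i = 1%R.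
Proof. by case: i => [[|[|//]] h]; [left|right]; apply/val_inj. Qed.

Lemma curvature_young m : curvature_law m young.
Proof.
move=> i f Pf fn.
(* [H a x] tests the residue of position (a+1, x), which is also that of the last cell of row [a]
   when [x > 0]; [T a] tests the residue of the first cell of row [a]. Between rows of equal length
   there is no corner, and the two terms cancel. *)
rewrite (@curvatureE _ _ below_monotone_young i
  (fun a x => (a.+1%:R - x%:R == i)%:Z%R) (fun a => (a%:R == i)%:Z%R)) //.
- by case: (Z2_cases i) => -> /=; rewrite /eta /=; ring.
- by move=> x y /=; lia.
- move=> a x y /= yx; rewrite /step_weight /=.
  case: ltnP => xy; last first.
    have -> : x = y by lia.
    by rewrite ifF ?subrr //; [case: eqP | lia].
  have -> : (0 < x) && (y <= x.-1) by lia.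
  have -> : (a%:R - x.-1%:R = a.+1%:R - x%:R :> 'Z_2)%R.
    by rewrite -[in RHS](prednK (leq_ltn_trans (leq0n y) xy)) -!natr1; ring.
  by do 2!case: eqP.
- by rewrite subr0.
- move=> a x; rewrite /step_weight row_charge_young /=.
  rewrite [a%:R%R]natr_Z2 [x%:R%R]natr_Z2 [a.+1%:R%R]natr_Z2 /=.
  by case: (Z2_cases i) => ->; case: (odd a); case: (odd x).
Qed.

Lemma curvature_strict m : curvature_law m strict.
Proof.
move=> i f Pf fn.
(* A row of length at most 1 blocks the first cell of the empty row below. [H] compensates for this
   by the indicator of residue 0 at length 0, and by the factor 2 at length 1, where the removed
   cell has weight 1 only. *)
rewrite (@curvatureE _ _ below_monotone_strict i
  (fun a x => if x is x'.+1 then 2 * ((uphalf x')%:R == i)%:Z else (0%R == i)%:Z)%R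
  (fun a => (0%R == i)%:Z%R)) //.
- by case: (Z2_cases i) => -> /=; rewrite /eta /=; ring.
- by move=> x y /=; lia.
- move=> a [|x] y /= yx; rewrite /step_weight /=.
    have -> : y = 0 by lia.
    by rewrite /= [_ == i]eq_sym; case: eqP.
  case: y yx => [|y] yx /=; last first.
    rewrite ltnS; case: ltnP => [|xy].
      by case: x {yx} => // x _; do 2!case: (_ == i).
    have -> : x = y.+1 by lia.
    by rewrite /=; case: (_ == i).
  by case: x yx => [|x] _ /=; case: (0%R == i) => //; case: (_ == i).
- move=> a [|x]; rewrite /step_weight row_charge_strict /=.
    by rewrite mulr0; case: (_ == i).
  rewrite natr_Z2 [(uphalf x)%:R%R]natr_Z2 /= uphalf_half oddD.
  by case: (Z2_cases i) => ->; case: (odd x); case: (odd x./2).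
Qed.

(** * Rows of a strict partition and triangular numbers *)

Lemma strict_row_count (F : nat -> nat) N :
  (forall k, k < N -> (F k.+1 == 0) || (F k.+1 < F k)) ->
  exists l, [/\ l <= F 0, l * l.+1 <= 2 * \sum_(k < N.+1) F k
    & \sum_(k < N.+1) F k = \sum_(k < N.+1) (F k).-1 + l].
Proof.
elim: N F => [|N IH] F HF.
  by exists (0 < F 0); rewrite !big_ord_recl !big_ord0; case: (F 0) => [|x]; split=> /=; lia.
have [k kN|l [l1 l2 l3]] := IH (fun k => F k.+1); first exact: HF.
(* The witness counts nonzero rows. Their lengths are distinct, so a nonzero row 0 has length at
   least [l + 1], the amount by which the triangular number grows. *)
exists ((0 < F 0) + l); rewrite big_ord_recl [\sum_(k < N.+2) _.-1]big_ord_recl.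
rewrite /= in l1 l2 l3 *; rewrite /bump /=.
under [\sum_(i < N.+1) F (1 + i)]eq_bigr do rewrite add1n.
under [\sum_(i < N.+1) (F (1 + i)).-1]eq_bigr do rewrite add1n.
have F10 := HF 0 isT; set s := \sum_(k < _) F _ in l2 l3 *; set t := \sum_(k < _) _ in l3 *.
case: (F 0) F10 => [|x] F10 /=; first by have -> : l = 0; [lia | split; lia].
have lx : l <= x by lia.
have E : (1 + l) * (1 + l).+1 = l * l.+1 + 2 * l.+1 by lia.
by split; lia.
Qed.

(** The numbers k(k+1)/2 for k from 1 to [l] are distinct triangular numbers between 1 and [n]. *)
Lemma leq_num_triangular n l : l * l.+1 <= 2 * n -> l <= num_triangular n.
Proof.
move=> ln.
have halfE k : (k * k.+1) %/ 2 * 2 = k * k.+1.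
  by rewrite divnK // dvdn2 oddM /= andbN.
rewrite /num_triangular -size_filter -[l](size_iota 1) -(size_map (fun k => (k * k.+1) %/ 2)).
apply: uniq_leq_size.
  rewrite map_inj_in_uniq ?iota_uniq // => x y _ _ E.
  have {}E : x * x.+1 = y * y.+1 by rewrite -(halfE x) E halfE.
  by case: (ltngtP x y) => // xy; have := ltn_mul xy xy; lia.
move=> t /mapP[k]; rewrite mem_iota => kl ->; rewrite mem_filter mem_iota.
have := halfE k; set h := (k * k.+1) %/ 2 => hE.
have k_l : k * k.+1 <= l * l.+1 by apply: leq_mul; lia.
have k2 : k <= k * k by rewrite leq_pmull; lia.
have kk : k * k.+1 = k * k + k by lia.
apply/andP; split; last lia.
have kh : k < h.+1 by lia.
by apply/existsP; exists (Ordinal kh).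
Qed.

(** * Powers of two along paths of strict partitions *)

Section Divisibility.
Variable m : nat.
Implicit Type f : shape m.

(** Cells minus nonempty rows. By [excess_inc] it is the exponent of 2 collected along any path from
    the empty shape to [f]. *)
Definition excess f := \sum_a (f a).-1.

Lemma excess_inc f a : 2 ^ excess f * wt strict (f a) = 2 ^ excess (inc f a).
Proof.
rewrite /excess (bigD1 a) //= [in RHS](bigD1 a) //= ffunE eqxx addn1 /=.
have -> : \sum_(i | i != a) (inc f a i).-1 = \sum_(i | i != a) (f i).-1.
  by apply: eq_bigr => b /negbTE ba; rewrite ffunE ba addn0.
by case: (f a) => [|x] /=; rewrite ?muln1 // addSn expnS mulnC.
Qed.

Lemma leq_excess f : admissible strict f -> ncells f = m.+1 ->
  m.+1 - num_triangular m.+1 <= excess f.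
Proof.
move=> /forallP Pf fn.
have [k km|l [_ l2 l3]] := @strict_row_count (row f) m; first exact: Pf (Ordinal km).
have sE (g : nat -> nat) : \sum_(k < m.+1) g (row f k) = \sum_a g (f a).
  by apply: eq_bigr => a _; rewrite rowE.
rewrite (sE id) -/(ncells f) fn in l2 l3; rewrite (sE predn) -/(excess f) in l3.
have := leq_num_triangular l2; lia.
Qed.

(** The factor [2 ^ excess f] stores the weights already collected, which makes the induction on [v]
    go through; when [v] is exhausted, [leq_excess] applies. *)
Lemma dvd_downs_strict v (u : shape m -> int) f : admissible strict f ->
  ncells f + size v = m.+1 ->
  ((2 ^ (m.+1 - num_triangular m.+1))%N %| ((2 ^ excess f)%N%:Z * downs strict v u f)%R)%Z.
Proof.
elim: v f => [|i v IH] f Pf /=.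
  rewrite addn0 => fn; apply: dvdz_mulr; rewrite dvdzE /=.
  by apply: dvdn_exp2l; apply: leq_excess.
move=> fn; rewrite /down big_distrr /=; apply: rpred_sum => a /andP[Pa _].
rewrite mulrA -PoszM excess_inc; apply: IH => //.
by rewrite ncells_inc addSnnS.
Qed.

End Divisibility.

(** * For ordinary partitions, removing cells is adjoint to adding them *)

Section Adjunction.
Variable m : nat.
Local Notation bounded := (m.+1.-tuple 'I_m.+2).
Implicit Types (la : bounded) (f : shape m) (u : shape m -> int).
Local Open Scope ring_scope.

Definition shape_of la : shape m := [ffun a => tnth la a : nat].
Definition tuple_of (f : shape m) : bounded := [tuple inord (f a) | a < m.+1].

Lemma shape_ofK : cancel shape_of tuple_of.
Proof.
by move=> la; apply: eq_from_tnth => a; rewrite tnth_mktuple ffunE inord_val.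
Qed.

Lemma tuple_ofK f : (forall a, f a <= m.+1)%N -> shape_of (tuple_of f) = f.
Proof. by move=> fm; apply/ffunP=> a; rewrite ffunE tnth_mktuple inordK // ltnS. Qed.

Lemma ups_admissible M w f : admissible M (empty_shape m) ->
  ups M w f != 0 -> admissible M f.
Proof.
move=> P0; case: w => [|j w] /=.
  by rewrite /vacuum; case: (f =P _) => [->|].
by apply: contraNT => Pf; rewrite /up big1 // => a /and3P[_ P _]; rewrite P in Pf.
Qed.

(** All weights of [young] are 1, so [down i] is the transpose of [up i], and transposing a product
    reverses the word. *)
Lemma downs_youngE v u : (size v <= m.+1)%N ->
  downs young v u (empty_shape m)
  = \sum_la ups young (rev v) (shape_of la) * u (shape_of la).
Proof.
have P0 : admissible young (empty_shape m) by apply/forallP => k; rewrite /row !ffunE.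
elim/last_ind: v u => [|v i IH] u.
  move=> _; have E0 : shape_of (tuple_of (empty_shape m)) = empty_shape m.
    by apply: tuple_ofK => a; rewrite ffunE.
  rewrite (bigD1 (tuple_of (empty_shape m))) //= E0 /vacuum eqxx mul1r big1 ?addr0 // => la.
  case: (_ =P empty_shape m) => [E|]; last by rewrite mul0r.
  by rewrite -E shape_ofK eqxx.
rewrite size_rcons => vn; rewrite downs_rcons IH; last exact: ltnW.
rewrite rev_rcons /= /down /up.
rewrite [LHS](eq_bigr _ (fun la _ => big_distrr _ _ _)) [RHS](eq_bigr _ (fun la _ => big_distrl _ _ _)) /=.
rewrite [LHS](exchange_big_dep predT) //= [RHS](exchange_big_dep predT) //=.
apply: eq_bigr => a _.
rewrite [RHS](reindex_onto (fun la => tuple_of (inc (shape_of la) a))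
  (fun la => tuple_of (dec (shape_of la) a))) /=; last first.
  move=> la /and4P[la0 _ _ _]; rewrite tuple_ofK ?decK ?shape_ofK // => b.
  by rewrite !ffunE; apply: leq_trans (leq_subr _ _) _; rewrite -ltnS.
rewrite [LHS]big_mkcond [RHS]big_mkcond; apply: eq_bigr => la _.
(* [tuple_of] garbles a row that outgrows its bound. Where this coefficient is nonzero, [la] has
   only [size v <= m] cells and one more cell still fits; elsewhere both sides vanish. *)
have [U0|Un0] := eqVneq (ups young (rev v) (shape_of la)) 0.
  rewrite U0 mul0r if_same; case: ifP => // /andP[/and4P[la0 _ _ _] /eqP E].
  suff -> : dec (shape_of (tuple_of (inc (shape_of la) a))) a = shape_of la by rewrite U0 mul0r.
  rewrite -[in RHS]E [RHS]tuple_ofK // => b.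
  by rewrite !ffunE; apply: leq_trans (leq_subr _ _) _; rewrite -ltnS.
have [Nla _] := ups_support Un0; rewrite size_rev in Nla.
have -> : shape_of (tuple_of (inc (shape_of la) a)) = inc (shape_of la) a.
  apply: tuple_ofK => b; apply: leq_trans (leq_ncells _ _) _.
  by rewrite ncells_inc Nla.
rewrite incK shape_ofK eqxx andbT (ups_admissible P0 Un0) ffunE [X in (0 < X)%N]ffunE.
by rewrite [inc _ _ _]ffunE ffunE eqxx addn1 mul1r.
Qed.
End Adjunction.

(** * Tableaux as paths of partitions *)

Section Tableaux.
Variable m : nat.
Local Notation n := m.+1.
Local Notation cell := ('I_n * 'I_n)%type.
Implicit Types (f : shape m) (T : filling n) (v : seq 'Z_2) (c d : cell).

(** Standard tableaux of any size [size v], all drawn in the same n x n square, so that deleting the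
    largest entry stays in one type of fillings. *)
Record partial_tableau v f T : Prop := PartialTableau {
  support_cell : forall c, (0 < T c) = (c.2 < f c.1);
  entry_bound : forall c, T c <= size v;
  entry_ex : forall k, 0 < k <= size v -> exists c, T c = k :> nat;
  entry_inj : forall c d, 0 < T c -> T c = T d -> c = d;
  row_incr : forall c d, 0 < T c -> 0 < T d -> c.1 = d.1 -> c.2 < d.2 -> T c < T d;
  col_incr : forall c d, 0 < T c -> 0 < T d -> c.2 = d.2 -> c.1 < d.1 -> T c < T d;
  entry_residue : forall c, 0 < T c -> residue c = nth 0%R v (T c).-1 }.

Definition partial_tableaub v f T : bool :=
  [&& [forall c, (0 < T c) == (c.2 < f c.1)],
      [forall c, T c <= size v],
      [forall k : 'I_(size v), exists c, T c == k.+1 :> nat],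
      [forall c, forall d, (0 < T c) && (T c == T d) ==> (c == d)],
      [forall c, forall d, [&& 0 < T c, 0 < T d, c.1 == d.1 & c.2 < d.2] ==> (T c < T d)],
      [forall c, forall d, [&& 0 < T c, 0 < T d, c.2 == d.2 & c.1 < d.1] ==> (T c < T d)]
    & [forall c, (0 < T c) ==> (residue c == nth 0%R v (T c).-1)]].

Lemma partial_tableauP v f T : reflect (partial_tableau v f T) (partial_tableaub v f T).
Proof.
apply: (iffP idP).
  case/and5P=> /forallP h1 /forallP h2 /forallP h3 /forallP h4.
  case/and3P=> /forallP h5 /forallP h6 /forallP h7.
  split.
  - by move=> c; have /eqP := h1 c.
  - exact: h2.
  - case=> // k /= kv; have /existsP[c /eqP] := h3 (Ordinal kv); by exists c.
  - by move=> c d c0 /eqP cd; have /forallP/(_ d) := h4 c; rewrite c0 cd => /eqP.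
  - by move=> c d c0 d0 /eqP e1 e2; have /forallP/(_ d) := h5 c; rewrite c0 d0 e1 e2.
  - by move=> c d c0 d0 /eqP e1 e2; have /forallP/(_ d) := h6 c; rewrite c0 d0 e1 e2.
  - by move=> c c0; have := h7 c; rewrite c0 => /eqP.
case=> h1 h2 h3 h4 h5 h6 h7; apply/and5P; split; last (apply/and3P; split).
- by apply/forallP => c; rewrite h1.
- by apply/forallP => c; apply: h2.
- by apply/forallP => k; have [|c e] := h3 k.+1; [exact: ltn_ord | apply/existsP; exists c; apply/eqP].
- by apply/forallP => c; apply/forallP => d; apply/implyP => /andP[c0 /eqP cd]; apply/eqP/h4.
- apply/forallP => c; apply/forallP => d; apply/implyP => /and4P[c0 d0 /eqP e1 e2]; exact: h5.
- apply/forallP => c; apply/forallP => d; apply/implyP => /and4P[c0 d0 /eqP e1 e2]; exact: h6.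
- by apply/forallP => c; apply/implyP => c0; apply/eqP/h7.
Qed.

Definition count_tableaux v f : nat := #|[set T | partial_tableaub v f T]|.

Definition row_end f (a : 'I_n) : cell := (a, inord (f a).-1).
Definition set_entry T c (k : 'I_n.+1) : filling n := [ffun d => if d == c then k else T d].

Lemma row_le f (a b : 'I_n) : admissible young f -> a <= b -> f b <= f a.
Proof.
move=> /forallP Pf; rewrite -!rowE; case: b => b bn /=; elim: b bn => [|b IH] bn.
  by rewrite leqn0 => /eqP ->.
rewrite leq_eqVlt => /orP[/eqP <- //|ab]; have bm : b < m by [].
apply: leq_trans (IH _ ab); last exact: ltnW.
exact: (Pf (Ordinal bm)).
Qed.

Lemma row_end_col f a : 0 < f a -> f a <= n -> (row_end f a).2 = (f a).-1 :> nat.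
Proof. by move=> fa fn; rewrite /= inordK //; lia. Qed.

Section Step.
Variables (v : seq 'Z_2) (i : 'Z_2) (f : shape m).
Hypotheses (Pf : admissible young f) (fv : ncells f = (size v).+1) (vn : size v < n).

Let fn a : f a <= n.
Proof. by apply: leq_trans (leq_ncells f a) _; rewrite fv. Qed.

(** A cell to the right of the largest entry would need a larger one. *)
Lemma last_entry_cell T c : partial_tableau (rcons v i) f T -> T c = (size v).+1 :> nat ->
  0 < f c.1 /\ c = row_end f c.1.
Proof.
move=> [supp bound _ _ row _ _] Tc.
have c_in : c.2 < f c.1 by rewrite -supp Tc.
have f0 : 0 < f c.1 by lia.
split=> //; case: (ltnP c.2.+1 (f c.1)) => h.
  have hn : c.2.+1 < n by apply: leq_trans h (fn _).
  pose d : cell := (c.1, Ordinal hn).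
  have := row c d; rewrite !supp Tc => /(_ c_in h erefl (ltnSn _)).
  by have := bound d; rewrite size_rcons; lia.
rewrite [LHS]surjective_pairing; congr (_, _); apply/val_inj.
by rewrite /= inordK; have := fn c.1; lia.
Qed.

(** The shape stays a partition because a cell under the largest entry would need a larger one. *)
Lemma remove_last T a : partial_tableau (rcons v i) f T -> 0 < f a ->
  T (row_end f a) = (size v).+1 :> nat ->
  [/\ admissible young (dec f a), res young a (f a).-1 = i
    & partial_tableau v (dec f a) (set_entry T (row_end f a) ord0)].
Proof.
move=> PT fa Te; case: (PT) => supp bound ex inj rowi coli resi.
have e2 := row_end_col fa (fn a).
split.
- rewrite admissible_dec //; last exact: below_monotone_young.
  apply/norP => -[am]; rewrite /= rowE -ltnNge => h.
  have an := ltn_ord a; have a1 : a.+1 < n by lia.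
  pose d : cell := (Ordinal a1, (row_end f a).2).
  have d_in : 0 < T d by rewrite supp e2 /=; move: h; rewrite /row (_ : inord a.+1 = Ordinal a1) //; apply/val_inj; rewrite /= inordK.
  have := coli (row_end f a) d; rewrite Te => /(_ isT d_in erefl (ltnSn _)).
  by have := bound d; rewrite size_rcons; lia.
- have := resi (row_end f a); rewrite Te /= nth_rcons ltnn eqxx => /(_ isT) <-.
  by rewrite /residue e2.
have neq c : c != row_end f a -> T c <> (size v).+1 :> nat.
  move=> ce Tc; case/eqP: ce; apply: inj; first by rewrite Tc.
  by apply/val_inj; rewrite /= Tc Te.
have setE c : 0 < set_entry T (row_end f a) ord0 c ->
    set_entry T (row_end f a) ord0 c = T c /\ c != row_end f a.
  by rewrite /set_entry ffunE; case: eqP.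
split.
- move=> c; rewrite /set_entry !ffunE; case: (c =P _) => [->|ce].
    by rewrite e2 /= eqxx; lia.
  rewrite supp; case: (c.1 =P a) => [E|_]; last by rewrite subn0.
  rewrite E /=; case: (ltngtP c.2 (f a).-1) => h; try lia.
  case: ce; rewrite [LHS]surjective_pairing E; congr (_, _).
  by apply/ord_inj; rewrite h; apply: esym e2.
- move=> c; rewrite /set_entry ffunE; case: eqP => // /eqP ce.
  by have := neq c ce; have := bound c; rewrite size_rcons; lia.
- move=> k kv; have [|c Tc] := ex k; first by rewrite size_rcons; lia.
  exists c; rewrite /set_entry ffunE; case: eqP => // ce.
  by move: kv; rewrite -Tc ce Te; lia.
- move=> c d c0 cd; have d0 := c0; rewrite cd in d0.
  have [cE _] := setE _ c0; have [dE _] := setE _ d0.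
  by rewrite cE dE in cd; rewrite cE in c0; apply: inj.
- move=> c d c0 d0; have [cE _] := setE _ c0; have [dE _] := setE _ d0.
  by rewrite cE in c0; rewrite dE in d0; rewrite cE dE; apply: rowi.
- move=> c d c0 d0; have [cE _] := setE _ c0; have [dE _] := setE _ d0.
  by rewrite cE in c0; rewrite dE in d0; rewrite cE dE; apply: coli.
move=> c c0; have [cE ce] := setE _ c0; rewrite cE in c0 *.
rewrite resi // nth_rcons; have := neq c ce; have := bound c; rewrite size_rcons.
by case: (ltnP (T c).-1 (size v)) => //; lia.
Qed.

(** Inverse to [remove_last]: the new entry exceeds all others and sits at a corner, with no cell to
    its right or below. *)
Lemma add_last T a : 0 < f a -> admissible young (dec f a) ->
  res young a (f a).-1 = i -> partial_tableau v (dec f a) T ->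
  T (row_end f a) = ord0 /\
  partial_tableau (rcons v i) f (set_entry T (row_end f a) (inord (size v).+1)).
Proof.
move=> fa Pd ri [supp bound ex inj rowi coli resi].
have e2 := row_end_col fa (fn a).
have kE : (inord (size v).+1 : 'I_n.+1) = (size v).+1 :> nat by rewrite inordK.
have Te : T (row_end f a) = ord0.
  apply/val_inj/eqP; rewrite /= -leqn0 leqNgt supp e2 ffunE /= eqxx; lia.
set T' := set_entry _ _ _.
have T'e : T' (row_end f a) = (size v).+1 :> nat by rewrite /T' /set_entry ffunE eqxx.
have T'c c : c != row_end f a -> T' c = T c by rewrite /T' /set_entry ffunE => /negbTE ->.
have supp' c : (0 < T' c) = (c.2 < f c.1).
  have [->|ce] := eqVneq c (row_end f a); first by rewrite T'e e2 /=; lia.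
  rewrite T'c // supp ffunE; case: (c.1 =P a) => [E|_]; last by rewrite subn0.
  rewrite E /=; case: (ltngtP c.2 (f a).-1) => h; try lia.
  case/eqP: ce; rewrite [LHS]surjective_pairing E; congr (_, _).
  by apply/ord_inj; rewrite h; apply: esym e2.
split=> //; split.
- exact: supp'.
- move=> c; rewrite size_rcons; have [->|ce] := eqVneq c (row_end f a); first by rewrite T'e.
  by rewrite T'c // ltnW // ltnS.
- move=> k; rewrite size_rcons => kv.
  have [->|kE'] := eqVneq k (size v).+1; first by exists (row_end f a).
  have [|c Tc] := ex k; first by lia.
  exists c; rewrite T'c //; apply/eqP => ce; move: kv; rewrite -Tc ce Te /=; lia.
- move=> c d; have [->|ce] := eqVneq c (row_end f a); have [->|de] := eqVneq d (row_end f a) => //.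
  + move=> _ /(congr1 val); rewrite /= T'e T'c // => E; have := bound d; lia.
  + move=> _ /(congr1 val); rewrite /= T'e T'c // => E; have := bound c; lia.
  + by rewrite !T'c //; apply: inj.
- move=> c d c0 d0; have [->|ce] := eqVneq c (row_end f a).
    move=> E1; rewrite e2 => h; move: d0; rewrite supp' -E1 /=; lia.
  have [->|de] := eqVneq d (row_end f a); first by rewrite T'c // T'e ltnS bound.
  by rewrite !T'c // in c0 d0 *; apply: rowi.
- move=> c d c0 d0; have [->|ce] := eqVneq c (row_end f a).
    move=> E1 /= h; move: d0; rewrite supp' -E1 e2.
    (* The row of [d] is no longer than row [a] of [dec f a], so it cannot reach the column of the
       new cell. *)
    have := row_le Pd (ltnW h); rewrite !ffunE eqxx (_ : d.1 == a = false); first by lia.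
    by apply/eqP => E; rewrite E ltnn in h.
  have [->|de] := eqVneq d (row_end f a); first by rewrite T'c // T'e ltnS bound.
  by rewrite !T'c // in c0 d0 *; apply: coli.
move=> c c0; have [->|ce] := eqVneq c (row_end f a).
  by rewrite T'e nth_rcons ltnn eqxx -ri /residue e2.
rewrite T'c // in c0 *; rewrite resi // nth_rcons.
by have := bound c; case: (ltnP (T c).-1 (size v)) => //; lia.
Qed.

Lemma count_tableaux_rcons : count_tableaux (rcons v i) f
  = \sum_(a | [&& 0 < f a, admissible young (dec f a) & res young a (f a).-1 == i])
      count_tableaux v (dec f a).
Proof.
pose k : 'I_n.+1 := inord (size v).+1.
have kE : k = (size v).+1 :> nat by rewrite inordK.
pose S := [set T | partial_tableaub (rcons v i) f T].
(* Exactly one row ends with the largest entry, so the inner sum equals 1; exchanging the sums sorts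
   the tableaux by that row. *)
have -> : count_tableaux (rcons v i) f
    = \sum_(T in S) \sum_(a | (0 < f a) && (T (row_end f a) == k)) 1.
  rewrite /count_tableaux -sum1_card; apply: eq_bigr => T; rewrite inE => /partial_tableauP PT.
  have [|c Tc] := entry_ex PT (k := (size v).+1); first by rewrite size_rcons leqnn.
  have [fc cE] := last_entry_cell PT Tc.
  rewrite (bigD1 c.1) /=; last by rewrite fc -cE -val_eqE /= Tc kE eqxx.
  rewrite big1 // => a /andP[/andP[fa /eqP Ta] ac]; case/eqP: ac.
  have := @entry_inj _ _ _ PT (row_end f a) c; rewrite Ta kE => /(_ isT) <- //.
  by apply/val_inj; rewrite /= kE Tc.
rewrite (exchange_big_dep predT) //= [RHS]big_mkcond /=; apply: eq_bigr => a _.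
rewrite sum1_card.
case: ifP => [/and3P[fa Pd /eqP ri]|H]; last first.
  apply: eq_card0 => T; rewrite unfold_in /= !inE; apply/negbTE/negP => /and3P[/partial_tableauP PT fa /eqP Ta].
  have [|Pd ri _] := remove_last PT fa _; first by rewrite Ta kE.
  by move/negP: H; apply; apply/and3P; split=> //; apply/eqP.
rewrite /count_tableaux; pose D := [set T | partial_tableaub v (dec f a) T].
rewrite -/D -(card_in_imset (D := mem D) (f := fun T => set_entry T (row_end f a) k)); last first.
  move=> T1 T2; rewrite !inE => /partial_tableauP P1 /partial_tableauP P2 /ffunP E.
  have [E1 _] := add_last fa Pd ri P1; have [E2 _] := add_last fa Pd ri P2.
  apply/ffunP => c; have := E c; rewrite /set_entry !ffunE.
  by case: eqP => // ->; rewrite E1 E2.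
apply: eq_card => T; rewrite unfold_in /= inE fa /=; apply/andP/imsetP.
  case=> /partial_tableauP PT /eqP Ta.
  have [|_ _ PT'] := remove_last PT fa _; first by rewrite Ta kE.
  exists (set_entry T (row_end f a) ord0); first by rewrite inE; apply/partial_tableauP.
  by apply/ffunP => c; rewrite /set_entry !ffunE; case: eqP => // ->.
case=> T'; rewrite inE => /partial_tableauP PT' ->.
have [_ PT] := add_last fa Pd ri PT'.
by split; [apply/partial_tableauP | rewrite /set_entry ffunE eqxx].
Qed.

End Step.

(** Both sides satisfy the recursion that deletes the last cell, which is the last letter of [v] but
    the head of the word read by [ups]. *)
Lemma count_tableauxE v f : admissible young f -> ncells f = size v -> size v <= n ->
  ((count_tableaux v f)%:Z = ups young (rev v) f)%R.
Proof.
elim/last_ind: v f => [|v i IH] f Pf.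
  move=> f0 _; have -> : f = empty_shape m.
    by apply/ffunP => a; rewrite ffunE; apply/eqP; rewrite -leqn0 -[0]f0 leq_ncells.
  rewrite /= /vacuum eqxx /count_tableaux (eq_card1 (x := [ffun=> ord0])) // => T.
  rewrite !inE; apply/partial_tableauP/eqP => [PT|->].
    by apply/ffunP => c; rewrite ffunE; apply/val_inj/eqP; rewrite /= -leqn0 (entry_bound PT).
  by split=> [c|c|k|c d|c d|c d|c]; rewrite ?ffunE //=; lia.
rewrite size_rcons rev_rcons /= => fv vn.
rewrite count_tableaux_rcons // /up -natz natr_sum.
apply: eq_big => [a|a /and3P[fa Pa _]]; first by rewrite Pf.
by rewrite natz IH ?(ltnW vn) //; have := ncells_dec fa; lia.
Qed.

Lemma C2_count_tableaux (v : n.-tuple 'Z_2) (la : n.-tuple 'I_n.+1) :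
  C2 v la = count_tableaux v (shape_of la).
Proof.
apply: eq_card => T; rewrite !inE; apply/andP/partial_tableauP.
  case=> /and4P[/forallP supp /forallP card1 /forallP rowi /forallP coli] /eqP resv.
  have supp' c : (0 < T c) = (c \in diagram la) by have /eqP := supp c.
  have uniq k : 0 < k <= n -> exists2 c, T c = k :> nat & forall d, T d = k :> nat -> d = c.
    case: k => // k /= kn; have /cards1P[c /setP E] := card1 (Ordinal kn).
    exists c; first by have := E c; rewrite !inE eqxx => /eqP.
    by move=> d Td; have := E d; rewrite !inE Td eqxx => /esym/eqP.
  have bound c : T c <= n by rewrite -ltnS ltn_ord.
  split.
  - by move=> c; rewrite supp' inE ffunE.
  - by move=> c; rewrite size_tuple.
  - by rewrite size_tuple => k /uniq[c Tc _]; exists c.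
  - move=> c d c0 cd; have [|e _ H] := uniq (T c); first by rewrite c0 bound.
    by rewrite (H c) // (H d) // cd.
  - move=> c d; rewrite !supp' => c0 d0 e1 e2.
    have /implyP/(_ c0)/forallP/(_ d)/implyP/(_ d0)/implyP := rowi c.
    by rewrite e1 eqxx e2; apply.
  - move=> c d; rewrite !supp' => c0 d0 e1 e2.
    have /implyP/(_ c0)/forallP/(_ d)/implyP/(_ d0)/implyP := coli c.
    by rewrite e1 eqxx e2; apply.
  - move=> c c0; have Tn : (T c).-1 < n by have := bound c; lia.
    rewrite -resv -[(T c).-1]/(nat_of_ord (Ordinal Tn)) -tnth_nth tnth_mktuple.
    (* The default of [pick] is excluded because [c] qualifies; uniqueness of the entry then gives
       [d = c]. *)
    case: pickP => [d /eqP /= Td|/(_ c)]; last by rewrite /= prednK // eqxx.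
    have [|e _ H] := uniq (T c); first by rewrite c0 bound.
    by rewrite (H c) // (H d) // Td prednK.
move=> [supp bound ex inj rowi coli resi]; rewrite size_tuple in bound ex.
have supp' c : (c \in diagram la) = (0 < T c) by rewrite supp inE ffunE.
split.
  apply/and4P; split.
  - by apply/forallP => c; rewrite supp'.
  - apply/forallP => k; have [|c Tc] := ex k.+1; first exact: ltn_ord.
    apply/cards1P; exists c; apply/setP => d; rewrite !inE.
    apply/eqP/eqP => [Td|-> //]; apply: inj; first by rewrite Td.
    by apply/val_inj; rewrite /= Td.
  - apply/forallP => c; apply/implyP; rewrite supp' => c0.
    apply/forallP => d; apply/implyP; rewrite supp' => d0.
    by apply/implyP => /andP[/eqP e1 e2]; apply: rowi.
  - apply/forallP => c; apply/implyP; rewrite supp' => c0.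
    apply/forallP => d; apply/implyP; rewrite supp' => d0.
    by apply/implyP => /andP[/eqP e1 e2]; apply: coli.
apply/eqP/eq_from_tnth => k; rewrite tnth_mktuple (tnth_nth 0%R).
case: pickP => [c /eqP Tc|H]; first by rewrite resi Tc.
have [|c Tc] := ex k.+1; first exact: ltn_ord.
by have := H c; rewrite Tc eqxx.
Qed.

Lemma C2_ups (v : n.-tuple 'Z_2) la : la \in partitions_of n ->
  ((C2 v la)%:Z = ups young (rev v) (shape_of la))%R.
Proof.
rewrite inE => /andP[/forallP mono /eqP sum_la].
rewrite C2_count_tableaux count_tableauxE ?size_tuple //.
  apply/forallP => k; rewrite /row !ffunE /=; have km := ltn_ord k.
  have /forallP/(_ (inord k.+1))/implyP := mono (inord k); apply.
  by rewrite !inordK //; lia.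
by rewrite -[RHS]sum_la; apply: eq_bigr => a _; rewrite ffunE.
Qed.

(** Restricts the sum over all tuples in [downs_youngE] to the partitions of n. *)
Lemma ups_not_partition w la : size w = n -> la \notin partitions_of n ->
  ups young w (shape_of la) = 0%R.
Proof.
move=> wn; apply: contraNeq => U; have [la_n _] := ups_support U.
have P0 : admissible young (empty_shape m) by apply/forallP => k; rewrite /row !ffunE.
have Pla := ups_admissible P0 U.
rewrite inE; apply/andP; split.
  apply/forallP => a; apply/forallP => b; apply/implyP => ab.
  by have := row_le Pla ab; rewrite !ffunE.
apply/eqP/(etrans _ (etrans la_n wn)); apply: eq_bigr => a _; by rewrite ffunE.
Qed.

Lemma sum_C2_pairing (v w : n.-tuple 'Z_2) :
  ((\sum_(la in partitions_of n) C2 v la * C2 w la)%N%:Z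
   = downs young v (ups young (rev w)) (empty_shape m))%R.
Proof.
rewrite downs_youngE ?size_tuple // -natz natr_sum [LHS]big_mkcond.
apply: eq_bigr => la _; case: ifP => [la_p|/negbT la_np].
  by rewrite natz PoszM !C2_ups.
by rewrite ups_not_partition ?mul0r // size_rev size_tuple.
Qed.

End Tableaux.

Theorem theorem1p2 (n : nat) (v w : n.-tuple 'Z_2) :
  0 < n ->
  2 ^ (n - num_triangular n)
    %| \sum_(la in partitions_of n) C2 v la * C2 w la.
Proof.
case: n v w => // m v w _.
have P1 : admissible young (empty_shape m) by apply/forallP => k; rewrite /row !ffunE.
have P2 : admissible strict (empty_shape m) by apply/forallP => k; rewrite /row !ffunE.
suff : ((2 ^ (m.+1 - num_triangular m.+1))%N
    %| (\sum_(la in partitions_of m.+1) C2 v la * C2 w la)%N%:Z)%Z by rewrite dvdzE.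
(* Pass from partitions to strict partitions, where the powers of 2 are visible. *)
rewrite sum_C2_pairing (@pairing_unique m young strict) ?size_tuple //; first last.
- exact: curvature_strict.
- exact: below_monotone_strict.
- exact: curvature_young.
- exact: below_monotone_young.
have := @dvd_downs_strict m v (ups strict (rev w)) _ P2.
(* The empty shape has excess 0, so the stored factor is 1. *)
rewrite ncells0 size_tuple /excess big1 ?mul1r; last by move=> a _; rewrite ffunE.
exact.
Qed.
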